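(* Let $\mathcal{C}$ be a hereditary graph class that is polynomially $\chi$-bounded. Then for every fixed $k\in\mathbb{N}$, the class of graphs that admit $\mathcal{C}$-governed decompositions of diversity at most $k$ is also polynomially $\chi$-bounded.
   Context: All graphs are finite and undirected. A class is hereditary if closed under induced subgraphs; it is polynomially $\chi$-bounded if some polynomial $f$ satisfies $\chi(G)\le f(\omega(G))$ for all its members. A decomposition of a graph $G=(V,E)$ is a pair $(T,\eta)$ where $T$ is a rooted tree and $\eta\colon V\to V(T)$ is an arbitrary map (no injectivity/surjectivity requirements; nodes may have any number of children). Write $x\preceq y$ if $x$ is an ancestor of $y$ (every node is its own ancestor). For an edge $e=uv$ of $G$, $\eta(e)$ is the least common ancestor of $\eta(u)$ and $\eta(v)$ in $T$. For a node $x$, let $V_x=\{v\in V:\eta(v)\succeq x\}$, $E_x=\{e\in E:\eta(e)=x\}$, and $G_x=(V_x,E_x)$. The decomposition is $\mathcal{C}$-governed if $G_x\in\mathcal{C}$ for every node $x$ of $T$. For a node $x$, the relation $\sim_x$ on $V_x$ is defined by $u\sim_x v$ iff $N^G(u)\setminus V_x=N^G(v)\setminus V_x$; the diversity of $x$ is the number of equivalence classes of $\sim_x$, and the diversity of $(T,\eta)$ is the maximum diversity over its nodes. *)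

(* Defs.v *)
From HB Require Import structures.
From mathcomp Require Import all_boot all_order all_algebra.

Set Implicit Arguments.
Unset Strict Implicit.
Unset Printing Implicit Defensive.

Import Order.TTheory GRing.Theory Num.Theory.

Record sgraph := SGraph {
  vertex :> finType;
  adj : rel vertex;
  adj_sym : symmetric adj;
  adj_irr : irreflexive adj
}.

Definition nbhd (G : sgraph) (u : G) : {set G} := [set v | adj u v].

Definition colorable (G : sgraph) (k : nat) : bool :=
  [exists c : {ffun G -> 'I_k}, forall u, forall v, adj u v ==> (c u != c v)].

Lemma colorable_card (G : sgraph) : colorable G #|G|.
Proof.
apply/existsP; exists [ffun u => enum_rank u].
apply/'forall_forallP => u v; apply/implyP => uv; rewrite !ffunE.
by apply: contraTneq uv => /enum_rank_inj ->; rewrite adj_irr.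
Qed.

Lemma ex_colorable (G : sgraph) : exists k, colorable G k.
Proof. by exists #|G|; apply: colorable_card. Qed.

Definition chi (G : sgraph) : nat := ex_minn (ex_colorable G).

Definition clique (G : sgraph) (S : {set G}) : bool :=
  [forall u in S, forall v in S, (u != v) ==> adj u v].

Definition omega (G : sgraph) : nat := \max_(S : {set G} | clique S) #|S|.

(* Up to isomorphism, the induced subgraphs of G are the graphs H with such a
   map; in particular a hereditary class is closed under isomorphism. *)
Definition induced_in (H G : sgraph) : Prop :=
  exists2 f : H -> G, injective f & forall u v, adj (f u) (f v) = adj u v.

Definition hereditary (C : sgraph -> Prop) : Prop :=
  forall H G : sgraph, induced_in H G -> C G -> C H.

(* The polynomial has coefficients in R, which can be any archimedean real
   field (the rationals, the reals, ...).  The archimedean property matters: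
   an infinitely large constant would bound every chromatic number. *)
Definition poly_chi_bounded (R : archiRealFieldType) (C : sgraph -> Prop) :
    Prop :=
  exists f : {poly R}, forall G : sgraph, C G ->
    ((chi G)%:R <= f.[(omega G)%:R])%R.

(* A finite rooted tree is given by its parent map; the root is its own parent,
   and every node reaches the root, so there is no other cycle. *)
Record rtree := RTree {
  node :> finType;
  root : node;
  parent : node -> node;
  parent_root : parent root = root;
  parent_to_root : forall x, fconnect parent x root
}.

Definition ancestor (T : rtree) (x y : T) : bool := fconnect (@parent T) y x.

Definition is_lca (T : rtree) (u v x : T) : bool :=
  [&& ancestor x u, ancestor x v &
      [forall z, (ancestor z u && ancestor z v) ==> ancestor z x]].

(* The default value is never used, see [lcaP]. *)
Definition lca (T : rtree) (u v : T) : T :=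
  odflt (root T) [pick x | is_lca u v x].

Lemma lcaP (T : rtree) (u v : T) : is_lca u v (lca u v).
Proof.
rewrite /lca; case: pickP => //= no_lca.
have ex_n : exists n, ancestor (iter n (@parent T) v) u.
  exists (findex (@parent T) v (root T)).
  by rewrite iter_findex ?parent_to_root // /ancestor parent_to_root.
case: (ex_minnP ex_n) => n anc_n min_n.
have /negP[] := negbT (no_lca (iter n (@parent T) v)).
rewrite /is_lca anc_n /ancestor fconnect_iter /=.
apply/forallP => z; apply/implyP => /andP[zu zv].
have le_n : n <= findex (@parent T) v z by apply: min_n; rewrite iter_findex.
by rewrite -(iter_findex zv) -(subnK le_n) iterD fconnect_iter.
Qed.

Lemma lcaC (T : rtree) (u v : T) : lca u v = lca v u.
Proof.
rewrite /lca; congr odflt; apply: eq_pick => x.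
rewrite /is_lca andbCA; do 2!congr (_ && _).
by apply: eq_forallb => z; rewrite [_ z u && _]andbC.
Qed.

Lemma ancestor_anti (T : rtree) : antisymmetric (@ancestor T).
Proof.
move=> x y /andP[yx xy].
have iter_root n : iter n (@parent T) (root T) = root T.
  by elim: n => //= n ->; rewrite parent_root.
have periodic_root z n : iter n.+1 (@parent T) z = z -> z = root T.
  move=> zz; have zm m : iter (m * n.+1) (@parent T) z = z.
    by elim: m => // m IHm; rewrite mulSn iterD IHm.
  have [p pE] : exists p, iter p (@parent T) z = root T.
    exists (findex (@parent T) z (root T)).
    by rewrite iter_findex ?parent_to_root.
  rewrite -{1}(zm p) -(subnK (leq_pmulr p (ltn0Sn n))) iterD pE.
  exact: iter_root.
have xE := iter_findex yx; have yE := iter_findex xy.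
case: (findex (@parent T) x y) yE => [|b] yE; first exact: yE.
have /periodic_root x_root :
    iter (findex (@parent T) y x + b).+1 (@parent T) x = x.
  by rewrite -addnS iterD yE xE.
by rewrite -yE x_root iter_root.
Qed.

Lemma lca_unique (T : rtree) (u v x : T) : is_lca u v x -> x = lca u v.
Proof.
have /and3P[lu lv /forallP lmax] := lcaP u v.
case/and3P=> xu xv /forallP xmax; apply: ancestor_anti.
by rewrite (implyP (lmax x)) ?xu ?xv // (implyP (xmax _)) ?lu ?lv.
Qed.

Record decomposition (G : sgraph) := Decomposition {
  dtree : rtree;
  eta : G -> dtree
}.

Section Decomposition.
Variables (G : sgraph) (D : decomposition G).
Implicit Type x : dtree D.

Definition eta_edge (u v : G) : dtree D := lca (eta D u) (eta D v).

Definition dverts x : {set G} := [set v | ancestor x (eta D v)].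

Definition dadj x : rel {v : G | v \in dverts x} :=
  fun u v => adj (val u) (val v) && (eta_edge (val u) (val v) == x).

Lemma dadj_sym x : symmetric (@dadj x).
Proof. by move=> u v; rewrite /dadj /eta_edge adj_sym lcaC. Qed.

Lemma dadj_irr x : irreflexive (@dadj x).
Proof. by move=> u; rewrite /dadj adj_irr. Qed.

Definition dgraph x : sgraph := SGraph (@dadj_sym x) (@dadj_irr x).

Definition governed (C : sgraph -> Prop) : Prop := forall x, C (dgraph x).

Definition same_outside x : rel G :=
  fun u v => nbhd u :\: dverts x == nbhd v :\: dverts x.

Definition node_diversity x : nat :=
  #|equivalence_partition (same_outside x) (dverts x)|.

Definition diversity : nat := \max_x node_diversity x.

End Decomposition.

Definition admits_governed (C : sgraph -> Prop) (k : nat) (G : sgraph) : Prop :=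
  exists2 D : decomposition G, governed D C & diversity D <= k.

(* Main.v *)
(* Write V_x for the set of vertices below the node x.  The type of a vertex v at
   x is its neighborhood outside V_x, and rank x y is the number of types at x
   met by V_y, for y a descendant of x; it is at most k and does not
   increase when y goes down.  By descending induction on m, one bounds the graphs whose
   edges are those with a least common ancestor in a set U of nodes such that all
   x < y in U satisfy rank x y >= m.  For m = k + 1, U is an antichain, and the
   graph is a disjoint union of induced subgraphs of graphs G_x.  For the step
   from m + 1 to m, let the level of y be the length of a longest chain of nodes
   in U, ending at y, whose consecutive members x < x' have rank x x' = m.
   Two comparable nodes of the same level have rank at least m + 1.  Color each
   vertex by its type at its topmost ancestor in U, and split the edges according
   to the parity of the level of their least common ancestor.  If x < y in U and
   rank x y = m, then going up from x merges no types of vertices of V_y, so that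
   vertices of V_y with the same color have the same type at x: inside a color
   class, V_y is a module with respect to the edges of level less than that of x.
   Hence each of the pieces arises by iterated substitution from graphs handled
   by induction.

   For iterated substitution, color a vertex by the sequence of records made at
   the nested modules around it, where a record is made only when the clique
   number drops by a factor of at least 2.  If the clique number drops from w to
   s, with 2^i <= s < 2^(i+1), then the record consists of i, of q = w / 2^i
   rounded down, and of a color in the graph of the modules with this i and q,
   whose clique number is at most q.  The number of colors at each record is
   polynomial in the ratio w / s, and these ratios multiply to at most the clique
   number of the graph, up to constant factors that occur logarithmically often.
   If an edge joins modules of clique numbers s and s' of a module of clique
   number w, then s + s' <= w, so at most one of its ends makes no record there;
   if one makes none, then its next record has a smaller q or another i. *)
Require Import Defs.
From mathcomp Require Import all_boot all_order all_algebra.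
From mathcomp Require Import zify.

Set Implicit Arguments.
Unset Strict Implicit.
Unset Printing Implicit Defensive.

Import Order.TTheory GRing.Theory Num.Theory.

Lemma leq_expl m n e : m <= n -> m ^ e <= n ^ e.
Proof. by case: e => // e le_mn; rewrite leq_exp2r. Qed.

(** * Colorings of relations *)

Section RelColoring.
Variable V : finType.
Implicit Types (e : rel V) (W S : {set V}).

Definition rcolorable e W n :=
  [exists c : {ffun V -> 'I_n},
     [forall u in W, forall v in W, e u v ==> (c u != c v)]].

Definition rclique e S := [forall u in S, forall v in S, (u != v) ==> e u v].

Definition romega e W := \max_(S : {set V} | (S \subset W) && rclique e S) #|S|.

(** Polynomial bounds are normalized to powers of the clique number plus 2: the base is at least 2,
    so constant factors go into the exponent. *)
Definition chi_le a e W := rcolorable e W ((romega e W).+2 ^ a).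

Lemma rcliqueP e S :
  reflect {in S &, forall u v, u != v -> e u v} (rclique e S).
Proof.
apply: (iffP forall_inP) => [h u v uS vS uv | h u uS].
  by have /forall_inP/(_ v vS)/implyP := h u uS; apply.
by apply/forall_inP => v vS; apply/implyP; apply: h.
Qed.

Lemma rcolorableI (K : eqType) (P : seq K) (c : V -> K) e W :
    0 < size P -> {in W, forall u, c u \in P} ->
    {in W &, forall u v, e u v -> c u != c v} ->
  rcolorable e W (size P).
Proof.
case: P => // x0 P _ cP c_proper.
apply/existsP; exists [ffun u => inord (index (c u) (x0 :: P))].
apply/forall_inP => u uW; apply/forall_inP => v vW; apply/implyP => uv.
have idx w : w \in W -> index (c w) (x0 :: P) < (size P).+1.
  by move=> wW; have := cP w wW; rewrite -index_mem.
rewrite !ffunE; apply: contraNneq (c_proper u v uW vW uv) => /(congr1 val).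
rewrite [LHS]inordK ?[RHS]inordK ?idx // => eq_idx.
by rewrite -(nth_index x0 (cP u uW)) eq_idx nth_index ?cP.
Qed.

Lemma rcolorable_nat (c : V -> nat) n e W :
    0 < n -> {in W, forall u, c u < n} ->
    {in W &, forall u v, e u v -> c u != c v} ->
  rcolorable e W n.
Proof.
move=> n_gt0 c_n c_proper; rewrite -(size_iota 0 n).
by apply: (rcolorableI (c := c)); rewrite ?size_iota // => u /c_n; rewrite mem_iota.
Qed.

Lemma rcolorableW m n e e' W W' :
    m <= n -> W' \subset W -> {in W' &, subrel e' e} ->
  rcolorable e W m -> rcolorable e' W' n.
Proof.
move=> le_mn /subsetP sW se /existsP[c /forall_inP c_proper].
apply/existsP; exists [ffun u => widen_ord le_mn (c u)].
apply/forall_inP => u uW; apply/forall_inP => v vW; apply/implyP => uv.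
rewrite !ffunE -val_eqE /=; have /forall_inP := c_proper u (sW u uW).
by move/(_ v (sW v vW))/implyP; apply; apply: se.
Qed.

Lemma rcolorable_union m n e1 e2 e W :
    {in W &, forall u v, e u v -> e1 u v || e2 u v} ->
  rcolorable e1 W m -> rcolorable e2 W n -> rcolorable e W (m * n).
Proof.
move=> e12 /existsP[c1 /forall_inP c1_proper] /existsP[c2 /forall_inP c2_proper].
have -> : m * n = #|{: 'I_m * 'I_n}| by rewrite card_prod !card_ord.
apply/existsP; exists [ffun u => enum_rank (c1 u, c2 u)].
apply/forall_inP => u uW; apply/forall_inP => v vW; apply/implyP => uv.
rewrite !ffunE (inj_eq enum_rank_inj) xpair_eqE negb_and.
have /forall_inP/(_ v vW)/implyP h1 := c1_proper u uW.
have /forall_inP/(_ v vW)/implyP h2 := c2_proper u uW.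
by case/orP: (e12 u v uW vW uv) => [/h1|/h2] -> //; rewrite orbT.
Qed.

(* The color classes of [c] need not be independent: each of them is colored
   separately, and only the edges inside a class matter. *)
Lemma rcolorable_classes m n (c : V -> 'I_m) e W :
    (forall i, rcolorable e [set u in W | c u == i] n) ->
  rcolorable e W (m * n).
Proof.
move=> c_class; pose e' : rel V := fun u v => e u v && (c u == c v).
apply: (rcolorable_union (e1 := fun u v => c u != c v) (e2 := e')) => //.
- by move=> u v _ _ uv; rewrite /e' uv; case: (c u == c v).
- apply/existsP; exists [ffun u => c u].
  apply/forall_inP => u _; apply/forall_inP => v _; apply/implyP.
  by rewrite !ffunE.
- have d i : {d : {ffun V -> 'I_n} | [forall u in [set u in W | c u == i],
      forall v in [set u in W | c u == i], e u v ==> (d u != d v)]}.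
    exact: sigW (existsP (c_class i)).
  apply/existsP; exists [ffun u => sval (d (c u)) u].
  apply/forall_inP => u uW; apply/forall_inP => v vW.
  apply/implyP => /andP[uv /eqP cuv]; rewrite !ffunE cuv.
  case: (d (c v)) => /= f /forall_inP/(_ u); rewrite inE uW cuv eqxx.
  by move/(_ isT)/forall_inP/(_ v); rewrite inE vW eqxx => /(_ isT)/implyP; apply.
Qed.

Lemma romega_ge e W S : S \subset W -> rclique e S -> #|S| <= romega e W.
Proof.
move=> sSW cS; rewrite /romega.
by apply: (@leq_bigmax_cond _ _ (fun S : {set V} => #|S|)); rewrite sSW.
Qed.

Lemma romega_le e W n :
  (forall S, S \subset W -> rclique e S -> #|S| <= n) -> romega e W <= n.
Proof. by move=> h; apply/bigmax_leqP => S /andP[]; apply: h. Qed.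

Lemma romega_ex e W :
  exists S, [/\ S \subset W, rclique e S & #|S| = romega e W].
Proof.
have [|S /andP[SW cS] eS] := @eq_bigmax_cond _
    [pred S : {set V} | (S \subset W) && rclique e S] (fun S => #|S|).
  apply/card_gt0P; exists set0; rewrite inE sub0set /=.
  by apply/rcliqueP => u v; rewrite inE.
by exists S; rewrite /romega eS.
Qed.

Lemma romegaW e e' W W' :
  W' \subset W -> {in W' &, subrel e' e} -> romega e' W' <= romega e W.
Proof.
move=> sW se; apply: romega_le => S SW /rcliqueP cS.
apply: romega_ge; first exact: subset_trans SW sW.
apply/rcliqueP => u v uS vS uv.
by apply: se; [exact: (subsetP SW) .. | exact: cS].
Qed.

Lemma romega_gt0 e W u : u \in W -> 0 < romega e W.
Proof.
move=> uW; rewrite -(cards1 u); apply: romega_ge; first by rewrite sub1set.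
by apply/rcliqueP => v w; rewrite !inE => /eqP-> /eqP->; rewrite eqxx.
Qed.

Lemma eq_chi_le a e e' W : {in W &, e =2 e'} -> chi_le a e W = chi_le a e' W.
Proof.
have sub e1 e2 : {in W &, e1 =2 e2} -> {in W &, subrel e1 e2}.
  by move=> ee u v uW vW; rewrite ee.
move=> ee; have ee' : {in W &, e' =2 e} by move=> u v uW vW; rewrite ee.
have om : romega e W = romega e' W.
  by apply/eqP; rewrite eqn_leq; apply/andP; split; apply: romegaW => //; apply: sub.
rewrite /chi_le om; apply/idP/idP; apply: rcolorableW => //; exact: sub.
Qed.

End RelColoring.

(** * Iterated substitution *)

Section Palette.
Variable a : nat.

(* The sequences of records (i, q, c) for a clique number less than 2 ^ s, with
   q.+2 ^ a colors for a graph of clique number at most q. *)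
Fixpoint valid s (r : seq (nat * nat * nat)) :=
  if r is (i, q, c) :: r' then
    [&& i.+1 < s, q < 2 ^ (s - i), c < q.+2 ^ a & valid i.+1 r']
  else true.

(** The range of colors depends on [s - i] and not on [q], so that the records for each [i] are
    counted by a product. *)
Fixpoint palette n s : seq (seq (nat * nat * nat)) :=
  [::] :: if n is n'.+1 then
    flatten [seq [seq (i, p.1, p.2) :: r |
                    p <- [seq (q, c) | q <- iota 0 (2 ^ (s - i)),
                                       c <- iota 0 (2 ^ ((s - i).+1 * a))],
                    r <- palette n' i.+1]
            | i <- iota 0 s.-1] else [::].

Lemma mem_palette n s r : valid s r -> size r <= n -> r \in palette n s.
Proof.
elim: n s r => [|n IHn] s [|[[i q] c] r] //= /and4P[i_s q_s c_q vr] le_n.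
rewrite inE /=; apply/flattenP.
exists [seq (i, p.1, p.2) :: r' |
          p <- [seq (q, c) | q <- iota 0 (2 ^ (s - i)),
                             c <- iota 0 (2 ^ ((s - i).+1 * a))],
          r' <- palette n i.+1].
  by apply/mapP; exists i => //; rewrite mem_iota; lia.
apply/allpairsP; exists ((q, c), r); split=> //=; last exact: IHn.
apply/allpairsP; exists (q, c); rewrite !mem_iota !add0n q_s /=; split=> //.
apply: leq_trans c_q _; rewrite expnM leq_expl // expnS.
have : 2 ^ 2 <= 2 ^ (s - i) by rewrite leq_exp2l //; lia.
lia.
Qed.

(** The bound is uniform in [n], so modules may be nested to any depth. *)
Lemma size_palette n s : size (palette n s) <= 2 ^ ((3 * a + 4) * s).
Proof.
elim: n s => [|n IHn] s /=; first by rewrite expn_gt0.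
case: s => [|s] //=; first by rewrite muln0.
set B := 3 * a + 4; rewrite size_flatten /shape -map_comp sumnE big_map.
have -> : iota 0 s = index_iota 0 s by rewrite /index_iota subn0.
have sum_pow m t : \sum_(0 <= i < t) 2 ^ (m + i) < 2 ^ (m + t).
  elim: t => [|t IHt]; first by rewrite big_nil expn_gt0.
  by rewrite big_nat_recr //= addnS expnS mul2n -addnn -addSn leq_add2r.
(* The sequences starting at [i] number at most [2 ^ (B * s.+1 - s.+1 + i)], a geometric
   progression; the strict bound on its sum leaves room for the empty sequence. *)
apply: leq_trans (_ : 2 ^ (B * s.+1 - s.+1 + s) <= _); last first.
  by rewrite leq_exp2l //; lia.
apply: leq_ltn_trans (sum_pow _ s); rewrite !big_seq; apply: leq_sum => i.
rewrite mem_index_iota => /andP[_ lt_i] /=; rewrite !size_allpairs !size_iota.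
apply: leq_trans (leq_mul (leqnn _) (IHn _)) _.
rewrite -!expnD leq_exp2l //.
have [d ->] : exists d, s = i + d.+1 by exists (s - i.+1); lia.
rewrite -addnS addKn /B; nia.
Qed.

End Palette.

(** * Coloring by traces through nested modules *)

Section Substitution.
Variables (V : finType) (e : rel V) (W : {set V}) (a n : nat) (b : nat -> rel V).

Definition layer j : rel V := fun u v => [&& e u v, b j u v & ~~ b j.+1 u v].

Hypothesis e_sym : symmetric e.
Hypothesis b_equiv : forall j, equivalence_rel (b j).
Hypothesis b_sub : forall j, subrel (b j.+1) (b j).
Hypothesis b_top : {in W &, forall u v, e u v -> b 0 u v}.
Hypothesis b_bot : {in W &, forall u v, b n u v -> ~~ e u v}.
Hypothesis b_module : forall j u u' w, u \in W -> u' \in W -> w \in W ->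
  b j.+1 u u' -> ~~ b j.+1 u w -> e u w = e u' w.
Hypothesis layer_chi_le : forall j (X : {set V}), X \subset W -> chi_le a (layer j) X.

Let b_refl j u : b j u u.
Proof. by have [] := b_equiv j u u u. Qed.

Let b_eql j u v : b j u v -> b j u =1 b j v.
Proof. by move=> uv w; have [_ ->] := b_equiv j u v w. Qed.

Let b_sym j : symmetric (b j).
Proof.
move=> u v; apply/idP/idP => h; first by rewrite -(b_eql h).
by rewrite -(b_eql h).
Qed.

Definition block j v := [set u in W | b j v u].
Definition weight j v := romega e (block j v).

Let mem_block j v : v \in W -> v \in block j v.
Proof. by move=> vW; rewrite inE vW b_refl. Qed.

Let block_eq j u v : b j u v -> block j u = block j v.
Proof. by move=> uv; apply/setP => w; rewrite !inE (b_eql uv). Qed.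

Let weight_eq j u v : b j u v -> weight j u = weight j v.
Proof. by move=> uv; rewrite /weight (block_eq uv). Qed.

Let weight_gt0 j v : v \in W -> 0 < weight j v.
Proof. by move=> vW; apply: romega_gt0 (mem_block j vW). Qed.

Let weight_sub j v : weight j.+1 v <= weight j v.
Proof.
apply: romegaW => //; apply/subsetP => u; rewrite !inE => /andP[-> h].
exact: b_sub.
Qed.

(* Since the blocks are modules, a clique of the layer can be blown up. *)
Lemma sum_weight_layer_clique j u0 (S : {set V}) :
    S \subset block j u0 -> rclique (layer j) S ->
  \sum_(u in S) weight j.+1 u <= weight j u0.
Proof.
move=> /subsetP S_block /rcliqueP cS.
have ex_M u : {M : {set V} | [&& M \subset block j.+1 u, rclique e M
                              & #|M| == weight j.+1 u]}.
  apply: sigW; have [M [MB cM eM]] := romega_ex e (block j.+1 u).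
  by exists M; rewrite MB cM eM eqxx.
pose M u := sval (ex_M u).
have MP u : [/\ M u \subset block j.+1 u, rclique e (M u) & #|M u| = weight j.+1 u].
  by rewrite /M; case: (ex_M u) => X /= /and3P[? ? /eqP].
have M_block u x : x \in M u -> (x \in W) && b j.+1 u x.
  by case: (MP u) => /subsetP sub _ _ /sub; rewrite inE.
have M_diff u v x y : u \in S -> v \in S -> u != v -> x \in M u -> y \in M v ->
    ~~ b j.+1 x y && e x y.
  move=> uS vS uv /M_block/andP[xW ux] /M_block/andP[yW vy].
  have /and3P[euv _ nuv] := cS u v uS vS uv.
  have := S_block u uS; have := S_block v vS; rewrite !inE.
  move=> /andP[vW _] /andP[uW _].
  have nuy : ~~ b j.+1 u y by rewrite b_sym -(b_eql vy) b_sym.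
  rewrite -(b_eql ux) nuy /= -(b_module uW xW yW ux nuy) e_sym.
  by rewrite -(b_module vW yW uW vy) ?(e_sym v) // b_sym.
have -> : \sum_(u in S) weight j.+1 u =
    #|[set p : V * V | (p.1 \in S) && (p.2 \in M p.1)]|.
  rewrite -sum1dep_card (eq_bigr (fun u => \sum_(x in M u) 1)); last first.
    by move=> u _; rewrite sum1_card; case: (MP u).
  by rewrite pair_big_dep.
rewrite -(card_in_imset (f := snd)); last first.
  move=> [u x] [v y] /=; rewrite !inE /= => /andP[uS xM] /andP[vS yM] xy.
  rewrite -{}xy in yM *; case: (eqVneq u v) => [-> // | uv].
  by have := M_diff u v x x uS vS uv xM yM; rewrite b_refl.
apply: romega_ge.
  apply/subsetP => w /imsetP[[u x]]; rewrite inE /= => /andP[uS xM] ->.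
  have /andP[xW ux] := M_block u x xM; rewrite inE xW /=.
  have := S_block u uS; rewrite inE => /andP[_ /b_eql ->].
  exact: b_sub.
apply/rcliqueP => w w' /imsetP[[u x]]; rewrite inE /= => /andP[uS xM] ->.
move=> /imsetP[[v y]]; rewrite inE /= => /andP[vS yM] -> xy.
have [euv | uv] := eqVneq u v.
  by rewrite -euv in yM; case: (MP u) => _ /rcliqueP cM _; apply: cM.
by have /andP[] := M_diff u v x y uS vS uv xM yM.
Qed.

Let weight_pair j u v : u \in W -> v \in W -> layer j u v ->
  weight j.+1 u + weight j.+1 v <= weight j u.
Proof.
move=> uW vW euv; have /and3P[_ buv nuv] := euv.
have uv : u != v by apply: contraNneq nuv => ->.
have <- : \sum_(x in [set u; v]) weight j.+1 x = weight j.+1 u + weight j.+1 v.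
  by rewrite big_setU1 ?inE //= big_set1.
apply: sum_weight_layer_clique.
  by apply/subsetP => x; rewrite !inE => /orP[]/eqP->; rewrite ?uW ?vW ?b_refl.
apply/rcliqueP => x y; rewrite !inE => /orP[]/eqP-> /orP[]/eqP->; rewrite ?eqxx //.
by rewrite /layer e_sym b_sym [b _ v u]b_sym.
Qed.

Definition light j i q :=
  [set v in W | (trunc_log 2 (weight j.+1 v) == i) && (weight j v %/ 2 ^ i == q)].

Let lightP j i q v : v \in light j i q ->
  [/\ v \in W, trunc_log 2 (weight j.+1 v) = i & weight j v %/ 2 ^ i = q].
Proof. by rewrite inE => /and3P[vW /eqP vi /eqP vq]. Qed.

(** Each vertex of a clique stands for a module of weight at least [2 ^ i], and these weights sum to
    at most the weight of the common block. *)
Lemma romega_light j i q : romega (layer j) (light j i q) <= q.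
Proof.
apply: romega_le => S /subsetP S_light cS.
have [-> | [u uS]] := set_0Vmem S; first by rewrite cards0.
have [uW ui uq] := lightP (S_light u uS).
rewrite -uq leq_divRL ?expn_gt0 //.
apply: leq_trans (sum_weight_layer_clique (u0 := u) _ cS).
  rewrite -sum_nat_const; apply: leq_sum => v vS.
  have [vW vi _] := lightP (S_light v vS).
  by rewrite -vi trunc_logP ?weight_gt0.
apply/subsetP => v vS; have [vW _ _] := lightP (S_light v vS).
rewrite inE vW; have [<- | uv] := eqVneq u v; first exact: b_refl.
by move/rcliqueP: cS => /(_ u v uS vS uv)/and3P[].
Qed.

Lemma light_coloring j i q : {c : {ffun V -> 'I_(q.+2 ^ a)} |
  [forall u in light j i q, forall v in light j i q,
     layer j u v ==> (c u != c v)]}.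
Proof.
apply: sigW; apply/existsP; pose X := light j i q.
apply: (rcolorableW (W := X) (e := layer j) (m := (romega (layer j) X).+2 ^ a)) => //.
  by rewrite leq_expl // !ltnS romega_light.
by apply: layer_chi_le; apply/subsetP => v /lightP[].
Qed.

Definition light_color j i q v : nat := sval (light_coloring j i q) v.

Fixpoint trace r j v : seq (nat * nat * nat) :=
  if r is r'.+1 then
    if weight j v < 2 * weight j.+1 v then trace r' j.+1 v else
    let i := trunc_log 2 (weight j.+1 v) in
    let q := weight j v %/ 2 ^ i in
    (i, q, light_color j i q v) :: trace r' j.+1 v
  else [::].

Lemma size_trace r j v : size (trace r j v) <= r.
Proof.
elim: r j => //= r IHr j; case: ifP => _ /=; last by rewrite ltnS.
exact: leq_trans (IHr _) (leqnSn r).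
Qed.

Lemma valid_trace r j v s : v \in W -> weight j v < 2 ^ s ->
  valid a s (trace r j v).
Proof.
move=> vW; elim: r j s => //= r IHr j s lt_s.
case: ltnP => [_ | h_light] /=.
  by apply: IHr; apply: leq_ltn_trans lt_s.
have lo := trunc_logP (isT : 1 < 2) (weight_gt0 j.+1 vW).
have hi := trunc_log_ltn (weight j.+1 v) (isT : 1 < 2).
set i := trunc_log 2 _ in lo hi *.
have lt_is : i.+1 < s.
  rewrite -(ltn_exp2l (m := 2)) //; apply: leq_ltn_trans lt_s.
  by apply: leq_trans h_light; rewrite expnS leq_mul2l lo.
rewrite lt_is IHr //= /light_color ltn_ord andbT.
by rewrite ltn_divLR ?expn_gt0 // -expnD subnK //; lia.
Qed.

Lemma head_trace r j v i q c t : v \in W -> trace r j v = (i, q, c) :: t ->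
  q * 2 ^ i <= weight j v.
Proof.
move=> vW; elim: r j => //= r IHr j; case: ifP => _.
  by move/IHr => h; apply: leq_trans h (weight_sub _ _).
by case=> <- <- _ _; apply: leq_divM.
Qed.

(* If [u] is recorded and [v] is not, then the two heads differ in [q]. *)
Let trace_light_heavy r j u v : u \in W -> v \in W -> layer j u v ->
  2 * weight j.+1 u <= weight j u -> weight j v < 2 * weight j.+1 v ->
  trace r.+1 j u != trace r.+1 j v.
Proof.
move=> uW vW euv h_light heavy /=; rewrite heavy ltnNge h_light /=.
(* Equal heads would give [q * 2 ^ i <= weight j.+1 v]; as [2 ^ i <= weight j.+1 u], [weight_pair]
   would contradict the rounding that defines [q]. *)
apply/eqP => /esym/(head_trace vW); rewrite leqNgt => /negP[].
set i := trunc_log 2 _; have lo := trunc_logP (isT : 1 < 2) (weight_gt0 j.+1 uW).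
have := weight_pair uW vW euv.
have := ltn_ceil (weight j u) (expn_gt0 2 i : 0 < 2 ^ i).
rewrite -/i in lo; rewrite mulSn; lia.
Qed.

Lemma trace_proper r j u v : j + r = n -> u \in W -> v \in W -> b j u v -> e u v ->
  trace r j u != trace r j v.
Proof.
move=> + uW vW; elim: r j => [|r IHr] j jr buv euv.
  by rewrite addn0 in jr; rewrite jr in buv; have := b_bot uW vW buv; rewrite euv.
have [buv' | nuv] := boolP (b j.+1 u v).
  have neq := IHr j.+1 _ buv' euv.
  rewrite /= -(weight_eq buv) -(weight_eq buv').
  case: ifP => _; first by apply: neq; lia.
  by apply/eqP => -[_ /eqP]; apply/negP; apply: neq; lia.
(* Two records with the same [i] and [q] use one proper coloring of the layer; a record against none
   is the previous lemma; no record on either side contradicts [weight_pair]. *)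
have luv : layer j u v by rewrite /layer euv buv nuv.
have lvu : layer j v u by rewrite /layer e_sym b_sym [b _ v u]b_sym.
have wuv := weight_eq buv.
have [heavy_u | light_u] := ltnP (weight j u) (2 * weight j.+1 u); last first.
  have [heavy_v | light_v] := ltnP (weight j v) (2 * weight j.+1 v).
    exact: trace_light_heavy.
  rewrite /= !ltnNge light_u light_v /=.
  apply/eqP => -[ei]; rewrite -ei => eq_q; rewrite -eq_q => ec _.
  set i := trunc_log 2 (weight j.+1 u) in ei eq_q ec; set q := weight j u %/ 2 ^ i in eq_q ec.
  have in_light w : w \in W -> trunc_log 2 (weight j.+1 w) = i ->
      weight j w %/ 2 ^ i = q -> w \in light j i q.
    by move=> wW wi wq; rewrite inE wW wi wq !eqxx.
  have ul := in_light u uW erefl erefl.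
  have vl := in_light v vW (esym ei) (esym eq_q).
  move: ec; rewrite /light_color; case: (light_coloring j i q) => /= c.
  move=> /forall_inP/(_ _ ul)/forall_inP/(_ _ vl) h /val_inj/eqP; apply/negP.
  exact: (implyP h).
rewrite eq_sym; apply: trace_light_heavy => //.
have := weight_pair uW vW luv; lia.
Qed.

Lemma substitution_chi_le : chi_le (2 * (3 * a + 4)) e W.
Proof.
pose s := (trunc_log 2 (romega e W)).+1.
have lt_s : romega e W < 2 ^ s by apply: trunc_log_ltn.
have P_gt0 : 0 < size (palette a n s) by case: (n).
rewrite /chi_le.
apply: (rcolorableW (m := size (palette a n s)) (W := W) (e := e)) => //.
  (* [2 ^ s] is at most twice the clique number, or 2 if that is 0, hence at most the square of
     [(romega e W).+2]. *)
  apply: leq_trans (size_palette _ _ _) _; rewrite mulnC expnM.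
  rewrite expnM; apply: leq_expl; rewrite /s expnS.
  have [-> | om_gt0] := posnP (romega e W); first by rewrite trunc_log0.
  have := trunc_logP (isT : 1 < 2) om_gt0; lia.
apply: (rcolorableI (c := trace n 0)) => // [u uW | u v uW vW euv].
  apply: mem_palette (size_trace _ _ _); apply: valid_trace => //.
  apply: leq_ltn_trans lt_s; apply: romegaW => //.
  by apply/subsetP => x; rewrite inE => /andP[].
by apply: trace_proper => //; apply: b_top.
Qed.

End Substitution.

(** * Types and ranks in a decomposition *)

Section Ancestors.
Variable T : rtree.
Implicit Types x y z : T.

Lemma ancestor_refl x : ancestor x x.
Proof. exact: connect0. Qed.

Lemma ancestor_trans y x z : ancestor x y -> ancestor y z -> ancestor x z.
Proof. by move=> xy yz; apply: connect_trans yz xy. Qed.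

Lemma ancestor_total x y z :
  ancestor x z -> ancestor y z -> ancestor x y || ancestor y x.
Proof.
move=> /iter_findex <- /iter_findex <-.
set i := findex _ _ _; set j := findex _ _ _.
case: (leqP i j) => [le_ij | /ltnW le_ji].
  by rewrite -(subnK le_ij) iterD /ancestor fconnect_iter orbT.
by rewrite -(subnK le_ji) iterD /ancestor fconnect_iter.
Qed.

Lemma ancestor_lca z x y : ancestor z (lca x y) = ancestor z x && ancestor z y.
Proof.
have /and3P[lx ly /forallP/(_ z)/implyP h] := lcaP x y.
apply/idP/andP => [zl | [zx zy]]; last by apply: h; rewrite zx.
by split; apply: ancestor_trans zl _.
Qed.

Lemma ancestor_inj x y : (forall z, ancestor z x = ancestor z y) -> x = y.
Proof.
by move=> h; apply: ancestor_anti; rewrite h ancestor_refl -h ancestor_refl.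
Qed.

Definition sancestor x y := (x != y) && ancestor x y.

Lemma sancestor_trans y x z : ancestor x y -> sancestor y z -> sancestor x z.
Proof.
move=> xy /andP[nyz yz]; rewrite /sancestor (ancestor_trans xy yz) andbT.
apply: contraNneq nyz => xz; apply/eqP/ancestor_anti.
by rewrite yz -xz xy.
Qed.

Lemma sancestor_transr y x z : sancestor x y -> ancestor y z -> sancestor x z.
Proof.
move=> /andP[nxy xy] yz; rewrite /sancestor (ancestor_trans xy yz) andbT.
apply: contraNneq nxy => xz; apply/eqP/ancestor_anti.
by rewrite xy xz yz.
Qed.

Definition depth x := #|[set z | ancestor z x]|.

Lemma sancestor_depth x y : sancestor x y -> depth x < depth y.
Proof.
move=> /andP[nxy xy]; apply: proper_card; apply/properP; split.
  by apply/subsetP => z; rewrite !inE => zx; apply: ancestor_trans zx xy.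
exists y; rewrite inE ?ancestor_refl //; apply: contra nxy => yx.
by apply/eqP/ancestor_anti; rewrite xy yx.
Qed.

Lemma depth_lt x : depth x < #|T|.+1.
Proof. by rewrite ltnS; apply: max_card. Qed.

End Ancestors.

Section Types.
Variables (G : sgraph) (D : decomposition G).
Implicit Types (x y z : dtree D) (u v w : G).

Definition type_at x v : {set G} := nbhd v :\: dverts x.
Definition rank x y := #|[set type_at x v | v in dverts y]|.

Lemma mem_dverts x v : (v \in dverts x) = ancestor x (eta D v).
Proof. by rewrite inE. Qed.

Lemma dverts_sub x y : ancestor x y -> dverts y \subset dverts x.
Proof.
by move=> xy; apply/subsetP => v; rewrite !inE; apply: ancestor_trans.
Qed.

Lemma ancestor_eta_edge z u v :
  ancestor z (eta_edge D u v) = (u \in dverts z) && (v \in dverts z).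
Proof. by rewrite ancestor_lca !mem_dverts. Qed.

(** A node above both [u] and [w] is comparable to [y] and not below it, so it is above [y] and
    hence above [u']. *)
Lemma eta_edge_outside y u u' w : u \in dverts y -> u' \in dverts y ->
  w \notin dverts y -> eta_edge D u w = eta_edge D u' w.
Proof.
move=> uy uy' wy; apply: ancestor_inj => z; rewrite !ancestor_eta_edge.
case wz: (w \in dverts z); rewrite ?andbF // !andbT.
have yz : ~~ ancestor y z.
  by apply: contra wy => /dverts_sub/subsetP; apply.
have zy v : v \in dverts y -> v \in dverts z -> ancestor z y.
  rewrite !mem_dverts => yv zv.
  by have := ancestor_total yv zv; rewrite (negPf yz).
by apply/idP/idP => [/(zy _ uy) | /(zy _ uy')] /dverts_sub/subsetP; apply.
Qed.

Lemma type_at_ancestor x0 x v : ancestor x0 x ->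
  type_at x0 v = type_at x v :\: dverts x0.
Proof.
move=> /dverts_sub/subsetP sub; apply/setP => w; rewrite !inE.
have := sub w; rewrite !inE; case: (ancestor x0 _) => //= h.
by case: (ancestor x _) h => // /(_ isT).
Qed.

Lemma rank_sub x y y' : ancestor y y' -> rank x y' <= rank x y.
Proof. by move=> yy; apply/subset_leq_card/imsetS/dverts_sub. Qed.

(** The classes of [same_outside x] map onto the types at [x], through the type of a
    representative. *)
Lemma rank_le_diversity x y : ancestor x y -> rank x y <= diversity D.
Proof.
move=> xy; apply: leq_trans (rank_sub x xy) _.
apply: leq_trans (_ : node_diversity x <= _); last first.
  exact: (@leq_bigmax _ (fun x => node_diversity x)).
pose f (B : {set G}) := if [pick v in B] is Some v then type_at x v else set0.
apply: leq_trans (leq_imset_card f _); apply/subset_leq_card/subsetP => A.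
case/imsetP => v vx ->; apply/imsetP.
exists [set w in dverts x | same_outside x v w].
  by apply/imsetP; exists v.
rewrite /f; case: pickP => [w | /(_ v)]; last by rewrite inE vx /same_outside eqxx.
by rewrite inE => /andP[_ /eqP].
Qed.

(* When passing from [x] to its ancestor [x0] does not merge the types at [x] of
   the vertices below [y], the type at [x0] determines the one at [x]. *)
Lemma type_at_inj x0 x y u v : ancestor x0 x -> rank x y <= rank x0 y ->
    u \in dverts y -> v \in dverts y ->
  type_at x0 u = type_at x0 v -> type_at x u = type_at x v.
Proof.
move=> x0x le_rank uy vy eq0; pose X := [set type_at x w | w in dverts y].
have /imset_injP inj : #|[set A :\: dverts x0 | A in X]| == #|X|.
  rewrite eqn_leq leq_imset_card /= -imset_comp.
  apply: leq_trans le_rank _; rewrite /rank.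
  by under eq_imset => w do rewrite (type_at_ancestor w x0x).
by apply: inj; rewrite -?type_at_ancestor // imset_f.
Qed.

End Types.

(** * Levels of nodes with respect to a relation inherited by descendants *)

Section Levels.
Variables (T : rtree) (U : {set T}) (r : rel T).
Hypothesis r_descend : forall x y y', r x y -> ancestor y y' -> r x y'.

Definition below x y := [&& x \in U, sancestor x y & r x y].

Fixpoint level_rec n y :=
  if n is n'.+1 then \max_(x | below x y) (level_rec n' x).+1 else 0.

(* The length of a longest chain of [below] ending at [y]. *)
Definition level y := level_rec (depth y) y.

(** Each recursive call goes to a strict ancestor, of smaller depth, so [depth y] is enough fuel. *)
Lemma level_recE n y : depth y <= n -> level_rec n y = level y.
Proof.
suff h k l z : depth z <= k -> depth z <= l -> level_rec k z = level_rec l z.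
  by move=> le_n; apply: h.
have depth_gt0 (x : T) : 0 < depth x.
  by apply/card_gt0P; exists x; rewrite inE ancestor_refl.
elim: k l z => [|k IHk] [|l] z //=.
- by rewrite leqNgt depth_gt0.
- by move=> _; rewrite leqNgt depth_gt0.
move=> zk zl; apply: eq_bigr => x /and3P[_ /sancestor_depth lt_xz _].
by congr _.+1; apply: IHk; rewrite -ltnS; apply: leq_trans lt_xz _.
Qed.

Lemma level_eq y : level y = \max_(x | below x y) (level x).+1.
Proof.
rewrite -(level_recE (leqnSn _)) /=; apply: eq_bigr => x.
by case/and3P=> _ /sancestor_depth/ltnW lt_xy _; rewrite level_recE.
Qed.

Lemma level_below x y : below x y -> level x < level y.
Proof.
by move=> xy; rewrite [level y]level_eq (@leq_bigmax_cond _ _ (fun x => (level x).+1)).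
Qed.

(** As [r] is inherited by descendants, every predecessor of [x] in a chain is also one of [y]. *)
Lemma level_ancestor x y : ancestor x y -> level x <= level y.
Proof.
move=> xy; rewrite level_eq; apply/bigmax_leqP => z /and3P[zU zx rzx].
apply: level_below; rewrite /below zU (r_descend rzx xy) andbT.
exact: sancestor_transr zx xy.
Qed.

Lemma level_pred y : 0 < level y -> exists2 x, below x y & level y = (level x).+1.
Proof.
rewrite level_eq => y_gt0.
have [|x xy eq_y] := @eq_bigmax_cond _ (below^~ y) (fun x => (level x).+1).
  rewrite lt0n; apply: contraTneq y_gt0 => /card0_eq none.
  by rewrite big_pred0.
by exists x.
Qed.

Lemma level_depth y : level y <= depth y.
Proof.
suff h n z : level_rec n z <= n by exact: h.
elim: n z => //= n IHn z.
by apply/bigmax_leqP => x _; rewrite ltnS.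
Qed.

End Levels.

Lemma parity_gap (p : bool) t l : odd l = p -> l < p + t.+1.*2 -> l <= p + t.*2.
Proof. by move=> <-; rewrite -{1 3}(odd_double_half l); lia. Qed.

(** With thresholds two apart, each layer of edges of one parity consists of a single level. *)
Lemma parity_layer (p : bool) t l :
  [&& odd l == p, p + t.*2 <= l & ~~ (p + t.+1.*2 <= l)] = (l == p + t.*2).
Proof.
apply/idP/eqP => [/and3P[/eqP l_p le_l] | ->].
  by rewrite -ltnNge => /(parity_gap l_p) ge_l; apply/eqP; rewrite eqn_leq ge_l.
by rewrite leqnn -ltnNge doubleS !addnS leqnSn oddD odd_double addbF; case: p.
Qed.

(** * Induction on the rank *)

Definition edges_in (G : sgraph) (D : decomposition G) (U : {set dtree D}) :
  rel G := fun u v => adj u v && (eta_edge D u v \in U).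

Definition rank_ge (G : sgraph) (D : decomposition G) m (U : {set dtree D}) :=
  {in U &, forall x y, sancestor x y -> m <= rank x y}.

Section RankStep.
Variables (G : sgraph) (D : decomposition G) (k a m : nat).
Variables (U : {set dtree D}).
Hypothesis diversity_k : diversity D <= k.
Hypothesis U_rank : rank_ge m U.
Hypothesis chi_le_rank_gt : forall (U' : {set dtree D}) (W : {set G}),
  rank_ge m.+1 U' -> chi_le a (edges_in U') W.

Local Notation low := (fun x y => rank x y <= m).
Local Notation lev := (level U low).

Let low_descend (x y y' : dtree D) : rank x y <= m -> ancestor y y' -> rank x y' <= m.
Proof. by move=> le_m yy; apply: leq_trans (rank_sub x yy) le_m. Qed.

Definition top (v : G) := [pick x in U |
  (v \in dverts x) && [forall y in U, (v \in dverts y) ==> ancestor x y]].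

(** Types are numbered separately at each top node, so all of them share [k.+1] colors; equal
    numbers mean equal types only under a common top node. *)
Definition top_type (v : G) : nat :=
  if top v is Some x then
    index (type_at x v) (enum [set type_at x u | u in dverts x]) else 0.

Lemma topP y v : y \in U -> v \in dverts y -> exists x, [/\ top v = Some x, x \in U,
  v \in dverts x & {in U, forall z, v \in dverts z -> ancestor x z}].
Proof.
move=> yU vy; pose P z := (z \in U) && (v \in dverts z).
have [|x /andP[xU vx] x_min] := @arg_minnP _ y P (@depth _); first by rewrite /P yU.
rewrite /top; case: pickP => [z /and3P[zU vz /forall_inP z_top] | /(_ x)].
  by exists z; split=> // z' z'U; apply/implyP; apply: z_top.
rewrite xU vx /= => /negbT/forall_inPn[z zU]; rewrite negb_imply => /andP[vz nxz].
have nzx : ~~ sancestor z x.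
  apply/negP => /sancestor_depth; rewrite ltnNge => /negP[].
  by apply: x_min; rewrite /P zU.
have := vx; have := vz; rewrite !mem_dverts => az ax.
move: (ancestor_total az ax); rewrite (negPf nxz) orbF => zx.
move: nzx; rewrite /sancestor zx andbT negbK => /eqP zx'.
by rewrite zx' ancestor_refl in nxz.
Qed.

Lemma top_type_lt v : top_type v < k.+1.
Proof.
rewrite /top_type /top; case: pickP => //= x /and3P[_ vx _].
apply: leq_trans (_ : rank x x < k.+1); last first.
  by rewrite ltnS (leq_trans _ diversity_k) // rank_le_diversity ?ancestor_refl.
rewrite ltnS /rank cardE; apply: ltnW.
by rewrite index_mem mem_enum imset_f.
Qed.

(** The top nodes of [u] and [v] are both above [y], so each contains both vertices; being topmost,
    they coincide. *)
Lemma top_type_inj y u v : y \in U -> u \in dverts y -> v \in dverts y ->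
  top_type u = top_type v ->
  exists2 x, x \in U & {in U, forall z, u \in dverts z -> ancestor x z} /\
    type_at x u = type_at x v.
Proof.
move=> yU uy vy; rewrite /top_type.
have [x [-> xU ux x_top]] := topP yU uy.
have [z [-> zU vz z_top]] := topP yU vy.
have xy := x_top y yU uy; have zy := z_top y yU vy.
have vx : v \in dverts x by apply: (subsetP (dverts_sub xy)).
have uz : u \in dverts z by apply: (subsetP (dverts_sub zy)).
have -> : z = x by apply: ancestor_anti; rewrite x_top ?z_top.
move=> eq_idx; exists x => //; split=> //.
set s := enum _ in eq_idx.
have mem_s w : w \in dverts x -> type_at x w \in s by move=> wx; rewrite mem_enum imset_f.
by rewrite -(nth_index set0 (mem_s u ux)) eq_idx nth_index ?mem_s.
Qed.

Section ParityClass.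
Variables (p : bool) (W : {set G}) (i : nat).
Hypothesis W_type : {in W, forall v, top_type v = i}.

Definition parity_nodes := [set x in U | odd (lev x) == p].
Local Notation e := (edges_in parity_nodes).

(** The blocks other than singletons are the sets [dverts y] for topmost [y] in [U] of level at
    least [p + t.*2], of either parity. *)
Definition blk t : rel G := fun u v => (u == v) ||
  [exists y in U, [&& p + t.*2 <= lev y, u \in dverts y & v \in dverts y]].

Let blk_node t u v y : y \in U -> p + t.*2 <= lev y -> u \in dverts y ->
  v \in dverts y -> blk t u v.
Proof.
by move=> yU ly uy vy; apply/orP; right; apply/exists_inP; exists y; rewrite ?ly ?uy.
Qed.

Let blkP t u v : blk t u v -> u != v ->
  exists y, [/\ y \in U, p + t.*2 <= lev y, u \in dverts y & v \in dverts y].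
Proof.
by case/orP=> [/eqP-> | /exists_inP[y yU /and3P[? ? ?]] _]; [rewrite eqxx | exists y].
Qed.

Let blk_sym t : symmetric (blk t).
Proof.
move=> u v; rewrite /blk eq_sym; congr (_ || _).
by apply: eq_existsb => y; rewrite [(u \in _) && _]andbC.
Qed.

Let blk_trans t : transitive (blk t).
Proof.
move=> v u w uv vw; have [-> // | nuv] := eqVneq u v.
have [<- // | nvw] := eqVneq v w.
have [y [yU ly uy vy]] := blkP uv nuv; have [z [zU lz vz wz]] := blkP vw nvw.
have := vy; have := vz; rewrite !mem_dverts => az ay.
case/orP: (ancestor_total az ay) => /dverts_sub/subsetP sub.
  exact: (blk_node zU lz (sub _ uy) wz).
exact: (blk_node yU ly uy (sub _ wz)).
Qed.

Let blk_equiv t : equivalence_rel (blk t).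
Proof.
apply/equivalence_relP; split; first by move=> u; rewrite /blk eqxx.
move=> u v uv w; apply/idP/idP; last exact: blk_trans.
by rewrite blk_sym in uv; apply: blk_trans.
Qed.

Let blk_sub t : subrel (blk t.+1) (blk t).
Proof.
move=> u v /orP[uv | /exists_inP[y yU /and3P[ly uy vy]]]; first by rewrite /blk uv.
by apply: (blk_node yU _ uy vy); apply: leq_trans ly; rewrite leq_add2l leq_double.
Qed.

Let edge_blk t u v : adj u v -> blk t u v = [exists y in U,
  (p + t.*2 <= lev y) && ancestor y (eta_edge D u v)].
Proof.
move=> uv; rewrite /blk; have -> : (u == v) = false.
  by apply: contraTF uv => /eqP->; rewrite adj_irr.
by apply: eq_existsb => y; rewrite ancestor_eta_edge.
Qed.

(** Levels do not decrease downwards, so no common ancestor has a higher level than the lowest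
    one. *)
Let edge_blk_lca t u v : adj u v -> eta_edge D u v \in U ->
  blk t u v = (p + t.*2 <= lev (eta_edge D u v)).
Proof.
move=> uv zU; rewrite edge_blk //; apply/exists_inP/idP => [[y yU /andP[ly]] | lz].
  by move/(level_ancestor U low_descend); apply: leq_trans.
by exists (eta_edge D u v); rewrite ?lz ?ancestor_refl.
Qed.

Let blk_module t u u' w : u \in W -> u' \in W ->
  blk t.+1 u u' -> ~~ blk t.+1 u w -> e u w = e u' w.
Proof.
move=> uW uW' buu' nbuw; have [-> // | nuu'] := eqVneq u u'.
have [y [yU ly uy uy']] := blkP buu' nuu'.
have wy : w \notin dverts y by apply: contra nbuw => wy; apply: (blk_node yU ly uy wy).
rewrite /edges_in -(eta_edge_outside uy uy' wy); set z := eta_edge D u w.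
case: (boolP (z \in parity_nodes)); rewrite ?andbF // !andbT.
rewrite inE => /andP[zU /eqP z_p].
have /andP[uz wz] : (u \in dverts z) && (w \in dverts z).
  by rewrite -ancestor_eta_edge ancestor_refl.
have lz : lev z < p + t.+1.*2.
  by rewrite ltnNge; apply: contra nbuw => lz; apply: (blk_node zU lz uz wz).
(* Thresholds jump by two: the level of this [x] is one less than that of [y] and still exceeds that
   of [z], so [w] is not below [x]. *)
have [|x /and3P[xU xy rxy] lxy] := @level_pred _ U low y.
  by apply: leq_trans ly; rewrite doubleS !addnS.
have lt_zx : lev z < lev x.
  by rewrite -ltnS -lxy; apply: leq_trans ly; rewrite doubleS !addnS !ltnS parity_gap.
have /andP[_ axy] := xy.
have ux : u \in dverts x by apply: (subsetP (dverts_sub axy)).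
have ux' : u' \in dverts x by apply: (subsetP (dverts_sub axy)).
have wx : w \notin dverts x.
  apply/negP => wx; have : ancestor x z by rewrite ancestor_eta_edge ux.
  by move/(level_ancestor U low_descend); rewrite leqNgt lt_zx.
have [x0 x0U [x0_top eq_x0]] :
    exists2 x0, x0 \in U & {in U, forall z, u \in dverts z -> ancestor x0 z} /\
      type_at x0 u = type_at x0 u'.
  by apply: (top_type_inj yU uy uy'); rewrite !W_type.
have x0x := x0_top x xU ux.
(* Here [rank x y <= m <= rank x0 y], so no types merge between [x] and [x0], and equality at [x0]
   carries over to [x]. *)
have : type_at x u = type_at x u'.
  apply: (type_at_inj x0x _ uy uy' eq_x0); apply: leq_trans rxy _.
  exact: U_rank x0U yU (sancestor_trans x0x xy).
by move/setP/(_ w); rewrite !inE -!mem_dverts wx.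
Qed.

Lemma chi_le_parity_class : chi_le (2 * (3 * a + 4)) e W.
Proof.
apply: (@substitution_chi_le _ e W a #|dtree D|.+1 blk) => //.
- by move=> u v; rewrite /edges_in /eta_edge lcaC adj_sym.
- move=> u v _ _ /andP[uv]; rewrite inE => /andP[zU /eqP z_p].
  by rewrite edge_blk_lca // -z_p; case: (lev _) => //= n; case: (odd n).
- move=> u v _ _ buv; apply/negP => /andP[uv]; rewrite inE => /andP[zU _].
  move: buv; rewrite edge_blk_lca // leqNgt => /negP[].
  (* No level exceeds the number of nodes, so the last threshold lies above all levels. *)
  apply: leq_ltn_trans (level_depth _ _ _) _.
  apply: ltn_trans (depth_lt _) _; rewrite doubleS !addnS ltnS -addnn.
  by apply: leq_trans (leq_addl _ _); apply: leq_addr.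
- by move=> t u u' w uW uW' _; apply: blk_module.
move=> t X _; pose U' := [set x in U | lev x == p + t.*2].
rewrite (eq_chi_le a (e' := edges_in U')); last first.
  move=> u v _ _; rewrite /layer /edges_in -andbA.
  case uv: (adj u v) => //=; rewrite !inE.
  case zU: (eta_edge D u v \in U) => //=; rewrite !edge_blk_lca //.
  exact: parity_layer.
apply: chi_le_rank_gt => x y; rewrite !inE => /andP[xU /eqP lx] /andP[yU /eqP ly] xy.
rewrite ltnNge; apply/negP => le_m.
have /(@level_below _ U low) : below U low x y by rewrite /below xU xy.
by rewrite lx ly ltnn.
Qed.

End ParityClass.

Lemma chi_le_rank_step W : chi_le (2 * (2 * (3 * a + 4)) + k.+1) (edges_in U) W.
Proof.
rewrite /chi_le; set w := romega _ _; set B := 2 * (3 * a + 4).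
pose c v : 'I_k.+1 := Ordinal (top_type_lt v).
(* One factor counts the types, the other two the parities; [k.+1 <= 2 ^ k.+1] accounts for the
   summand [k.+1] in the exponent. *)
apply: (rcolorableW (m := k.+1 * (w.+2 ^ B * w.+2 ^ B)) (W := W) (e := edges_in U)) => //.
  rewrite -expnD addnn -mul2n mulnC expnD leq_mul2l; apply/orP; right.
  apply: leq_trans (ltnW (ltn_expl k.+1 (isT : 1 < 2))) _.
  exact: leq_expl.
apply: (rcolorable_classes (c := c)) => i.
have sub p : rcolorable (edges_in (parity_nodes p)) [set u in W | c u == i] (w.+2 ^ B).
  set Wi := [set _ in W | _].
  have : chi_le B (edges_in (parity_nodes p)) Wi.
    by apply: (@chi_le_parity_class _ _ i) => u; rewrite inE => /andP[_ /eqP<-].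
  apply: rcolorableW => //; apply: leq_expl; rewrite !ltnS.
  apply: romegaW; first by apply/subsetP => u; rewrite inE => /andP[].
  by move=> u v _ _ /andP[uv]; rewrite inE /edges_in uv => /andP[].
apply: (rcolorable_union (e1 := edges_in (parity_nodes true))
                         (e2 := edges_in (parity_nodes false))) => //.
move=> u v _ _ /andP[uv zU]; rewrite /edges_in uv !inE zU /=.
by case: (odd _).
Qed.

End RankStep.

Lemma rcolorable_chi (H : sgraph) n (W : {set H}) :
  chi H <= n -> rcolorable (@adj H) W n.
Proof.
rewrite /chi; case: ex_minnP => m /existsP[c /'forall_forallP c_proper] _ le_mn.
apply: (rcolorableW (W := W) (e := @adj H) le_mn) => //.
apply/existsP; exists c; apply/forall_inP => u _; apply/forall_inP => v _.
exact: c_proper.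
Qed.

Lemma romega_setT (H : sgraph) : romega (@adj H) setT = omega H.
Proof. by apply: eq_bigl => S; rewrite subsetT. Qed.

(** * Base case: single nodes and antichains *)

Section Base.
Variables (C : sgraph -> Prop) (a : nat).
Hypothesis C_hereditary : hereditary C.
Hypothesis C_chi : forall H, C H -> chi H <= (omega H).+2 ^ a.
Variables (G : sgraph) (D : decomposition G).
Hypothesis D_governed : governed D C.

(** On [W] these edges form, up to isolated vertices, an induced subgraph of [dgraph x], to which
    heredity applies. *)
Lemma chi_le_node x W : chi_le a (edges_in [set x : dtree D]) W.
Proof.
pose X := [set v in W | v \in dverts x].
pose e : rel {v : G | v \in X} := fun u v => edges_in [set x] (val u) (val v).
have e_sym : symmetric e.
  by move=> u v; rewrite /e /edges_in /eta_edge adj_sym lcaC.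
have e_irr : irreflexive e by move=> u; rewrite /e /edges_in adj_irr.
pose H := SGraph e_sym e_irr.
have X_dverts (v : H) : val v \in dverts x.
  by have := valP v; rewrite inE => /andP[].
have CH : C H.
  apply: (C_hereditary _ (D_governed x)).
  exists (fun v : H => exist _ (val v) (X_dverts v) : dgraph x).
    by move=> u v [] /val_inj.
  by move=> u v; rewrite /= /e /edges_in inE.
have om : omega H <= romega (edges_in [set x]) W.
  rewrite -romega_setT; apply: romega_le => S _ /rcliqueP cS.
  rewrite -(card_imset _ val_inj); apply: romega_ge.
    by apply/subsetP => _ /imsetP[v _ ->]; have := valP v; rewrite inE => /andP[].
  apply/rcliqueP => _ _ /imsetP[u uS ->] /imsetP[v vS ->]; rewrite val_eqE.
  exact: cS.
have := C_chi CH; move/(fun h => leq_trans h (leq_expl a _)).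
move=> /(_ (romega (edges_in [set x]) W).+2); rewrite !ltnS => /(_ om).
move/(rcolorable_chi setT); rewrite /chi_le; set n := _ ^ a.
case/existsP => c /forall_inP c_proper.
apply: (rcolorable_nat (c := fun v => if insub v is Some u then c u : nat else 0)).
- by rewrite expn_gt0.
- by move=> v _; case: insubP => // _; rewrite expn_gt0.
move=> u v uW vW uv; have /andP[ux vx] : (u \in dverts x) && (v \in dverts x).
  by rewrite -ancestor_eta_edge; case/andP: uv => _ /set1P->; rewrite ancestor_refl.
have uX : u \in X by rewrite inE uW.
have vX : v \in X by rewrite inE vW.
rewrite !insubT val_eqE; have /forall_inP := c_proper (Sub u uX) (in_setT _).
by move=> /(_ (Sub v vX) (in_setT _))/implyP; apply.
Qed.

(** Nodes of an antichain have disjoint sets [dverts], so the colorings of the single nodes can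
    share one palette. *)
Lemma chi_le_antichain (U : {set dtree D}) W :
  {in U &, forall x y, ancestor x y -> x = y} -> chi_le a (edges_in U) W.
Proof.
move=> U_anti; rewrite /chi_le; set n := _ ^ a.
have col x : {c : {ffun G -> 'I_n} | (x \in U) ==>
    [forall u in W, forall v in W, edges_in [set x] u v ==> (c u != c v)]}.
  apply: sigW; case xU: (x \in U) => /=; last first.
    have n_gt0 : 0 < n by rewrite expn_gt0.
    by exists [ffun=> Ordinal n_gt0].
  apply/existsP; have sub : subrel (edges_in [set x]) (@edges_in G D U).
    by move=> u v /andP[uv /set1P zx]; rewrite /edges_in uv zx.
  apply: (rcolorableW (W := W) (e := edges_in [set x])) (chi_le_node x W) => //.
  by apply: leq_expl; rewrite !ltnS; apply: romegaW => // u v _ _; apply: sub.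
pose c v : nat := if [pick x in U | v \in dverts x] is Some x then sval (col x) v else 0.
apply: (rcolorable_nat (c := c)); first by rewrite expn_gt0.
  by move=> v _; rewrite /c; case: pickP => *; rewrite ?expn_gt0.
move=> u v uW vW /andP[uv zU]; set z := eta_edge D u v in zU.
have /andP[uz vz] : (u \in dverts z) && (v \in dverts z).
  by rewrite -ancestor_eta_edge ancestor_refl.
have pick_z w : w \in dverts z -> [pick x in U | w \in dverts x] = Some z.
  move=> wz; case: pickP => [x /andP[xU wx] | /(_ z)]; last by rewrite zU wz.
  congr Some; move: wx wz; rewrite !mem_dverts => xw zw.
  by case/orP: (ancestor_total xw zw) => /U_anti ->.
rewrite /c !pick_z //; case: (col z) => /= d; rewrite zU /=.
move=> /forall_inP/(_ u uW)/forall_inP/(_ v vW)/implyP; apply.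
by rewrite /edges_in uv set11.
Qed.

End Base.

(** * Assembling the induction and returning to polynomials *)

Definition rank_step k a := 2 * (2 * (3 * a + 4)) + k.+1.

Lemma chi_le_rank (C : sgraph -> Prop) a k (G : sgraph) (D : decomposition G)
    j (U : {set dtree D}) (W : {set G}) :
    hereditary C -> (forall H, C H -> chi H <= (omega H).+2 ^ a) ->
    governed D C -> diversity D <= k -> rank_ge (k.+1 - j) U -> j <= k.+1 ->
  chi_le (iter j (rank_step k) a) (edges_in U) W.
Proof.
move=> C_hereditary C_chi D_governed D_k.
elim: j U W => [|j IHj] U W U_rank le_j /=.
  apply: (chi_le_antichain C_hereditary C_chi D_governed) => x y xU yU xy.
  (* Two distinct comparable nodes would have rank at least [k.+1], above the diversity. *)
  apply/eqP/negPn/negP => nxy; have := U_rank x y xU yU.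
  rewrite /sancestor nxy xy subn0 ltnNge => /(_ isT)/negP[].
  exact: leq_trans (rank_le_diversity xy) D_k.
apply: chi_le_rank_step D_k U_rank _ W => U' W'; rewrite subnSK // => U'_rank.
by apply: IHj => //; apply: ltnW.
Qed.

(** By Horner's scheme: a coefficient is at most some natural [m], by the archimedean property, and
    [m] is less than [n.+2 ^ m]. *)
Lemma horner_le_expn (R : archiRealFieldType) (f : {poly R}) :
  exists a, forall n, (f.[n%:R] <= (n.+2 ^ a)%:R)%R.
Proof.
elim/poly_ind: f => [|f c [a f_a]]; first by exists 0 => n; rewrite horner0 ler0n.
have [m c_m] : exists m : nat, (c <= m%:R)%R.
  by exists (Num.bound `|c|%R); apply: le_trans (ler_norm c) (ltW (archi_boundP _)).
exists (a + m).+2 => n; rewrite hornerMXaddC.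
apply: (@le_trans _ _ ((n.+2 ^ a * n + m)%:R)%R).
  by rewrite natrD natrM lerD // ler_wpM2r ?ler0n.
rewrite ler_nat; apply: leq_trans (_ : n.+2 ^ a.+1 * n.+2 ^ m.+1 <= _); last first.
  by rewrite -expnD addSn addnS.
have m_le : m < n.+2 ^ m by apply: ltn_expl.
have a_gt0 : 0 < n.+2 ^ a by rewrite expn_gt0.
rewrite !expnS; nia.
Qed.

Theorem theorem2p5 (R : archiRealFieldType) (C : sgraph -> Prop)
  (hC : hereditary C) (bC : poly_chi_bounded R C) (k : nat) :
  poly_chi_bounded R (admits_governed C k).
Proof.
have [f f_C] := bC; have [a f_a] := horner_le_expn f.
have C_chi H : C H -> chi H <= (omega H).+2 ^ a.
  by move=> CH; rewrite -(ler_nat R); apply: le_trans (f_C H CH) (f_a _).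
exists (('X + 2%:R%:P) ^+ iter k.+1 (rank_step k) a)%R => G [D D_governed D_k].
(* With all nodes in [U] every edge is kept, and after [k.+1] steps the rank condition reads
   [0 <= rank x y]. *)
have := @chi_le_rank C a k G D k.+1 setT setT hC C_chi D_governed D_k.
rewrite subnn => /(_ (fun _ _ _ _ _ => leq0n _) (leqnn _)).
rewrite (eq_chi_le _ (e' := @adj G)) => [|u v _ _]; last first.
  by rewrite /edges_in in_setT andbT.
rewrite /chi_le romega_setT => /existsP[c /forall_inP c_proper].
rewrite horner_exp hornerD hornerX hornerC -natrD -natrX ler_nat addn2.
rewrite /chi; case: ex_minnP => m _; apply; apply/existsP; exists c.
apply/'forall_forallP => u v.
by have /forall_inP := c_proper u (in_setT u); apply; apply: in_setT.
Qed.
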